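(* Let $p>1$ and $N\ge 2m-1$. For almost all $(A,y)\in\mathbb R^{m\times N}\times\mathbb R^m$, the unique optimal solution $x^*$ of $\min_{x\in\mathbb R^N}\|x\|_p$ subject to $Ax=y$ satisfies $|\mathrm{supp}(x^* )|=N$.
   Context: $\|x\|_p:=(\sum_i|x_i|^p)^{1/p}$; $\mathrm{supp}(x)=\{i:x_i\ne0\}$. ''For almost all'' means outside a set of Lebesgue measure zero. *)

(* Defs.v *)
From Stdlib Require Import Reals Lra Lia.
Open Scope R_scope.

Fixpoint sumR (n : nat) (f : nat -> R) : R :=
  match n with O => 0 | S k => sumR k f + f k end.

(* s^q for s >= 0, with the convention 0^q = 0 (q > 0) *)
Definition rpow0 (s q : R) : R :=
  if Rle_dec s 0 then 0 else Rpower s q.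

(* ||x||_p = (sum_{i<N} |x_i|^p)^(1/p), x : R^N given by its first N coords *)
Definition pnorm (p : R) (N : nat) (x : nat -> R) : R :=
  rpow0 (sumR N (fun i => rpow0 (Rabs (x i)) p)) (1 / p).

Fixpoint supp_size (N : nat) (x : nat -> R) : nat :=
  match N with
  | O => O
  | S k => (supp_size k x + (if Req_EM_T (x k) 0 then 0 else 1))%nat
  end.

Definition feasible (m N : nat) (A : nat -> nat -> R) (y x : nat -> R) : Prop :=
  forall i, (i < m)%nat -> sumR N (fun j => A i j * x j) = y i.

Definition optimal (p : R) (m N : nat) (A : nat -> nat -> R) (y x : nat -> R) : Prop :=
  feasible m N A y x /\
  forall x', feasible m N A y x' -> pnorm p N x <= pnorm p N x'.

(* Lebesgue null sets in R^k (points given by their first k coordinates):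
   for every eps > 0, S is covered by countably many closed boxes of total
   volume <= eps. *)
Definition in_box (k : nat) (a b z : nat -> R) : Prop :=
  forall i, (i < k)%nat -> a i <= z i <= b i.

Fixpoint box_vol (k : nat) (a b : nat -> R) : R :=
  match k with O => 1 | S j => box_vol j a b * (b j - a j) end.

Definition lebesgue_null (k : nat) (S : (nat -> R) -> Prop) : Prop :=
  forall eps, 0 < eps ->
  exists a b : nat -> nat -> R,
    (forall n i, (i < k)%nat -> a n i <= b n i) /\
    (forall z, S z -> exists n, in_box k (a n) (b n) z) /\
    (forall M, sumR M (fun n => box_vol k (a n) (b n)) <= eps).

(* coordinates of (A, y) in R^{m x N} x R^m = R^{mN + m} *)
Definition mat_of (N : nat) (z : nat -> R) : nat -> nat -> R :=
  fun i j => z (i * N + j)%nat.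
Definition vec_of (m N : nat) (z : nat -> R) : nat -> R :=
  fun i => z (m * N + i)%nat.

Definition good (p : R) (m N : nat) (A : nat -> nat -> R) (y : nat -> R) : Prop :=
  exists x, optimal p m N A y x /\
    (forall x', optimal p m N A y x' -> forall i, (i < N)%nat -> x' i = x i) /\
    supp_size N x = N.

(* Main.v *)
(* With r = 1 + 1/(p-1) the conjugate exponent, a minimiser l of the convex dual functional
   sum_j |(A^T l)_j|^r - r <y, l> exists as soon as A^T is injective, and the vector
   x_j = sign(a_j . l) |a_j . l|^(r-1) (a_j the columns of A) is then feasible; strict convexity of
   |t|^p makes it the unique solution.  Hence x_j = 0 forces l to be orthogonal to a_j.
   So a bad (A, y) with y <> 0 either has a nontrivial kernel of A^T, or comes from some l <> 0
   orthogonal to some a_j.  Each of these conditions parametrises the bad points by at most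
   mN + m - 1 real numbers (for the first one because N >= m) through a map that is Lipschitz
   on each piece of a countable decomposition, and Lipschitz images of bounded subsets of a
   hyperplane are null, by covering them with small cubes.  The decomposition keeps each a_i . l
   either equal to 0 or bounded away from 0, where sign(t) |t|^(r-1) may fail to be Lipschitz. *)
Require Import Defs.
From Stdlib Require Import Reals Lra Lia List FinFun Classical ClassicalEpsilon Cantor.
Open Scope R_scope.

(** * Finite sums and elementary bounds *)

Lemma Rabs_bounds x r : Rabs x <= r -> - r <= x <= r.
Proof. unfold Rabs; destruct (Rcase_abs x); lra. Qed.

Lemma sumR_ext n f g :
  (forall i, (i < n)%nat -> f i = g i) -> sumR n f = sumR n g.
Proof.
  intros H; induction n as [|n IH]; simpl; [reflexivity|].
  rewrite IH, (H n) by (intros; try apply H; lia); reflexivity.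
Qed.

Lemma sumR_le n f g :
  (forall i, (i < n)%nat -> f i <= g i) -> sumR n f <= sumR n g.
Proof.
  intros H; induction n as [|n IH]; simpl; [lra|].
  apply Rplus_le_compat; [apply IH; intros; apply H|apply H]; lia.
Qed.

Lemma sumR_zero n : sumR n (fun _ => 0) = 0.
Proof. induction n; simpl; lra. Qed.

Lemma sumR_const n c : sumR n (fun _ => c) = INR n * c.
Proof. induction n; [simpl; ring|]. rewrite S_INR; simpl; lra. Qed.

Lemma sumR_nonneg n f : (forall i, (i < n)%nat -> 0 <= f i) -> 0 <= sumR n f.
Proof. intros H; rewrite <- (sumR_zero n); apply sumR_le, H. Qed.

Lemma sumR_plus n f g : sumR n (fun i => f i + g i) = sumR n f + sumR n g.
Proof. induction n; simpl; lra. Qed.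

Lemma sumR_minus n f g : sumR n (fun i => f i - g i) = sumR n f - sumR n g.
Proof. induction n; simpl; lra. Qed.

Lemma sumR_scal n c f : sumR n (fun i => c * f i) = c * sumR n f.
Proof. induction n as [|n IH]; simpl; [ring|rewrite IH; ring]. Qed.

Lemma sumR_swap m n (f : nat -> nat -> R) :
  sumR m (fun i => sumR n (fun j => f i j)) = sumR n (fun j => sumR m (fun i => f i j)).
Proof.
  induction m as [|m IH]; simpl; [now rewrite sumR_zero|].
  rewrite IH; symmetry; apply sumR_plus.
Qed.

Lemma sumR_remove n k f :
  (k < n)%nat -> sumR n f = f k + sumR n (fun i => if Nat.eqb i k then 0 else f i).
Proof.
  induction n as [|n IH]; intros Hk; [lia|]; simpl.
  destruct (Nat.eq_dec k n) as [->|Hne].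
  - rewrite Nat.eqb_refl, (sumR_ext n (fun i => if Nat.eqb i n then 0 else f i) f); [lra|].
    intros i Hi; destruct (Nat.eqb_spec i n); [lia|reflexivity].
  - rewrite IH by lia. destruct (Nat.eqb_spec n k); [lia|lra].
Qed.

Lemma sumR_term_le n f k :
  (forall i, (i < n)%nat -> 0 <= f i) -> (k < n)%nat -> f k <= sumR n f.
Proof.
  intros H Hk; rewrite (sumR_remove n k f Hk).
  enough (0 <= sumR n (fun i => if Nat.eqb i k then 0 else f i)) by lra.
  apply sumR_nonneg; intros i Hi; destruct (Nat.eqb i k); [lra|auto].
Qed.

Lemma sumR_eq0 n f :
  (forall i, (i < n)%nat -> 0 <= f i) -> sumR n f <= 0 ->
  forall i, (i < n)%nat -> f i = 0.
Proof.
  intros H H0 i Hi. pose proof (sumR_term_le n f i H Hi). specialize (H i Hi); lra.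
Qed.

Lemma sumR_abs n f : Rabs (sumR n f) <= sumR n (fun i => Rabs (f i)).
Proof.
  induction n as [|n IH]; simpl; [rewrite Rabs_R0; lra|].
  eapply Rle_trans; [apply Rabs_triang|lra].
Qed.

(** Monotonicity in the second argument lets the maximum of finitely many witnesses serve every
    index. *)
Lemma uniform_index K (P : nat -> nat -> Prop) :
  (forall i a b, (a <= b)%nat -> P i a -> P i b) ->
  (forall i, (i < K)%nat -> exists n, P i n) ->
  exists n, forall i, (i < K)%nat -> P i n.
Proof.
  intros Hm H; induction K as [|K IH]; [exists O; lia|].
  destruct IH as [n Hn]; [intros; apply H; lia|].
  destruct (H K) as [n' Hn']; [lia|].
  exists (max n n'); intros i Hi.
  destruct (Nat.eq_dec i K) as [->|]; [apply (Hm K n')|apply (Hm i n); [|apply Hn]]; auto; lia.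
Qed.

Lemma INR_unbounded x : exists n, x <= INR n.
Proof.
  destruct (INR_archimed 1 x) as [n Hn]; [lra|]. exists n; lra.
Qed.

Lemma inv_INR_small x : 0 < x -> exists n, / INR (S n) <= x.
Proof.
  intros Hx; destruct (INR_unbounded (/ x)) as [n Hn]; exists n.
  rewrite <- (Rinv_inv x); apply Rinv_le_contravar; [now apply Rinv_0_lt_compat|].
  rewrite S_INR; lra.
Qed.

(** * Null sets and their countable unions *)

Lemma null_mono k (S T : (nat -> R) -> Prop) :
  (forall z, S z -> T z) -> lebesgue_null k T -> lebesgue_null k S.
Proof.
  intros HST HT eps He. destruct (HT eps He) as (a & b & H1 & H2 & H3).
  exists a, b; auto.
Qed.

Lemma box_vol_nonneg k a b : (forall i, (i < k)%nat -> a i <= b i) -> 0 <= box_vol k a b.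
Proof.
  induction k as [|k IH]; intros H; simpl; [lra|].
  apply Rmult_le_pos; [apply IH; intros; apply H; lia|].
  assert (a k <= b k) by (apply H; lia); lra.
Qed.

(** Sums over lists allow comparison by inclusion of index sets, which the reindexing of double sums
    needs. *)
Definition lsum (l : list R) : R := fold_right Rplus 0 l.

Lemma lsum_app l l' : lsum (l ++ l') = lsum l + lsum l'.
Proof. induction l as [|x l IH]; simpl; [lra|]. unfold lsum in *; simpl; lra. Qed.

Lemma sumR_lsum n f : sumR n f = lsum (map f (seq 0 n)).
Proof.
  induction n as [|n IH]; [reflexivity|].
  rewrite seq_S, map_app, lsum_app; simpl; rewrite IH; unfold lsum; simpl; lra.
Qed.

Lemma lsum_incl {T} (g : T -> R) l l' :
  (forall x, 0 <= g x) -> NoDup l -> incl l l' -> lsum (map g l) <= lsum (map g l').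
Proof.
  intros Hg Hl; revert l'; induction Hl as [|x l Hx Hl IH]; intros l' Hi; simpl.
  - clear Hi; induction l' as [|x l' IH]; simpl; [lra|]. specialize (Hg x); unfold lsum in *; simpl in *; lra.
  - destruct (in_split x l') as (l1 & l2 & ->); [apply Hi; now left|].
    assert (H : incl l (l1 ++ l2)).
    { intros y Hy. assert (Hy' : In y (l1 ++ x :: l2)) by (apply Hi; now right).
      apply in_app_iff in Hy'; apply in_app_iff. destruct Hy' as [|[->|]]; tauto. }
    apply IH in H. rewrite map_app, lsum_app in *; simpl. unfold lsum in *; simpl in *; lra.
Qed.

Lemma lsum_prod {T U} (g : T * U -> R) l l' :
  lsum (map g (list_prod l l')) = lsum (map (fun i => lsum (map (fun j => g (i, j)) l')) l).
Proof.
  induction l as [|x l IH]; simpl; [reflexivity|].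
  rewrite map_app, lsum_app, IH, map_map; reflexivity.
Qed.

(** Both components of the pair coded by [t] are at most [t], and the coding is injective, so the
    first [M] codes are distinct points of the [M] by [M] square. *)
Lemma sumR_cantor_le M (g : nat * nat -> R) :
  (forall x, 0 <= g x) ->
  sumR M (fun t => g (Cantor.of_nat t)) <= sumR M (fun i => sumR M (fun j => g (i, j))).
Proof.
  intros Hg.
  rewrite (sumR_ext M (fun i => sumR M _) (fun i => lsum (map (fun j => g (i, j)) (seq 0 M))))
    by (intros; apply sumR_lsum).
  rewrite !sumR_lsum, <- lsum_prod, <- (map_map Cantor.of_nat g).
  apply lsum_incl; [exact Hg| |].
  - apply Injective_map_NoDup; [|apply seq_NoDup].
    intros x y H; rewrite <- (Cantor.cancel_to_of x), H; apply Cantor.cancel_to_of.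
  - intros x Hx; apply in_map_iff in Hx as (t & <- & Ht); apply in_seq in Ht.
    destruct (Cantor.of_nat t) as [i j] eqn:E.
    pose proof (Cantor.to_nat_non_decreasing i j) as H.
    rewrite <- E, Cantor.cancel_to_of in H.
    apply in_prod; apply in_seq; lia.
Qed.

Lemma sumR_half M : sumR M (fun n => (/ 2) ^ (S n)) <= 1.
Proof.
  enough (sumR M (fun n => (/ 2) ^ (S n)) = 1 - (/2) ^ M) as ->.
  { assert (0 < (/2)^M) by (apply pow_lt; lra); lra. }
  induction M as [|M IH]; [simpl; lra|]. simpl in *; lra.
Qed.

(** The [n]-th set is covered with volume at most [eps / 2^(n+1)], and the pairing of naturals
    merges the covers into one sequence of boxes. *)
Lemma null_union k (S : nat -> (nat -> R) -> Prop) :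
  (forall n, lebesgue_null k (S n)) -> lebesgue_null k (fun z => exists n, S n z).
Proof.
  intros H eps He.
  assert (C : forall n, {ab : (nat -> nat -> R) * (nat -> nat -> R) |
    (forall t i, (i < k)%nat -> fst ab t i <= snd ab t i) /\
    (forall z, S n z -> exists t, in_box k (fst ab t) (snd ab t) z) /\
    (forall M, sumR M (fun t => box_vol k (fst ab t) (snd ab t)) <= eps * (/ 2) ^ (Datatypes.S n))}).
  { intros n; apply constructive_indefinite_description.
    destruct (H n (eps * (/ 2) ^ (Datatypes.S n))) as (a & b & H1 & H2 & H3).
    - apply Rmult_lt_0_compat; [lra|apply pow_lt; lra].
    - exists (a, b); auto. }
  set (a := fun x : nat * nat => fst (proj1_sig (C (fst x))) (snd x)).
  set (b := fun x : nat * nat => snd (proj1_sig (C (fst x))) (snd x)).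
  assert (Hab : forall x i, (i < k)%nat -> a x i <= b x i).
  { intros [n t] i Hi; unfold a, b; simpl; destruct (C n) as [ab Hab]; simpl; now apply Hab. }
  exists (fun t => a (Cantor.of_nat t)), (fun t => b (Cantor.of_nat t)).
  split; [intros; now apply Hab|]; split.
  - intros z [n Hz]. destruct (proj1 (proj2 (proj2_sig (C n))) z Hz) as [t Ht].
    exists (Cantor.to_nat (n, t)); rewrite Cantor.cancel_of_to; exact Ht.
  - intros M.
    eapply Rle_trans; [apply (sumR_cantor_le M (fun x => box_vol k (a x) (b x)))|].
    { intros x; apply box_vol_nonneg, Hab. }
    apply Rle_trans with (sumR M (fun n => eps * (/ 2) ^ (Datatypes.S n))).
    + apply sumR_le; intros n _; unfold a, b; simpl; apply (proj2 (proj2 (proj2_sig (C n)))).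
    + rewrite sumR_scal. pose proof (sumR_half M). nra.
Qed.

Lemma null_union_bounded k n (S : nat -> (nat -> R) -> Prop) :
  (0 < n)%nat -> (forall i, (i < n)%nat -> lebesgue_null k (S i)) ->
  lebesgue_null k (fun z => exists i, (i < n)%nat /\ S i z).
Proof.
  intros Hn H.
  (* Clamping the index turns the finite family into an infinite one, all of whose members are
     null. *)
  apply null_mono with (fun z => exists i, S (Nat.min i (n - 1)) z).
  - intros z (i & Hi & Hz); exists i; now replace (Nat.min i (n - 1)) with i by lia.
  - apply null_union; intros i; apply H; lia.
Qed.

Lemma null_or k (S T : (nat -> R) -> Prop) :
  lebesgue_null k S -> lebesgue_null k T -> lebesgue_null k (fun z => S z \/ T z).
Proof.
  intros HS HT.
  apply null_mono with (fun z => exists n, match n with O => S z | _ => T z end).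
  - intros z [H|H]; [exists 0%nat|exists 1%nat]; exact H.
  - apply null_union; intros [|n]; assumption.
Qed.

(** * Lipschitz images of bounded pieces of a hyperplane *)

Lemma unit_cell M w : 0 <= w <= INR M -> (0 < M)%nat ->
  exists s, (s < M)%nat /\ INR s <= w <= INR s + 1.
Proof.
  induction M as [|M IH]; intros Hw HM; [lia|].
  destruct (Rle_dec w (INR M)) as [Hle|Hle].
  - destruct M as [|M]; [exists O; simpl in *; split; [lia|lra]|].
    destruct IH as (s & Hs & Hws); [lra|lia|]. exists s; split; [lia|lra].
  - exists M; rewrite S_INR in Hw; split; [lia|lra].
Qed.

(* The hyperplane section [u c = 0] only needs one cell in direction [c],
   hence [M ^ (K - 1)] cells instead of [M ^ K] as soon as [c < K]. *)
Lemma slice_grid M c B K : (0 < M)%nat -> 0 < B ->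
  exists g : nat -> nat -> R, forall u : nat -> R,
    u c = 0 -> (forall i, (i < K)%nat -> Rabs (u i) <= B) ->
    exists t, (t < M ^ (if Nat.ltb c K then K - 1 else K))%nat /\
      forall i, (i < K)%nat -> Rabs (u i - g t i) <= 2 * B / INR M.
Proof.
  intros HM HB.
  assert (HM' : 0 < INR M) by now apply lt_0_INR.
  assert (Hr : 0 < 2 * B / INR M) by (apply Rdiv_lt_0_compat; lra).
  induction K as [|K [g IH]].
  { exists (fun _ _ => 0); intros u _ _; exists O; split; [simpl; lia|lia]. }
  destruct (Nat.lt_trichotomy c K) as [Hc|[->|Hc]].
  (* The cell number is read in base [M]: the last digit selects the cell along coordinate [K], the
     quotient the cell for the earlier coordinates. A cell is represented by its lower corner along
     [K], hence the error of at most one side [2 * B / INR M]. *)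
  1,3: exists (fun t i => if Nat.eqb i K then - B + INR (t mod M) * (2 * B / INR M)
                      else g (t / M)%nat i).
  1,2: intros u Hu HuB; destruct (IH u Hu) as (t & Ht & Hg); [intros; apply HuB; lia|].
  1,2: assert (HuK : Rabs (u K) <= B) by (apply HuB; lia).
  1,2: apply Rabs_bounds in HuK.
  1,2: destruct (unit_cell M ((u K + B) / (2 * B / INR M))) as (s & Hs & Hws); [|exact HM|].
  1,3: split; [apply Rle_mult_inv_pos; lra|]; apply (Rmult_le_reg_r (2 * B / INR M)); [lra|];
       field_simplify; lra.
  1,2: exists (t * M + s)%nat; split.
  1,3: destruct (Nat.ltb_spec c K); try lia; destruct (Nat.ltb_spec c (S K)); try lia.
  1: replace (S K - 1)%nat with (S (K - 1)) by lia.
  1,2: rewrite Nat.pow_succ_r'; nia.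
  1,2: intros i Hi; replace ((t * M + s) mod M)%nat with s
    by (rewrite Nat.add_comm, Nat.Div0.mod_add, Nat.mod_small; lia);
    replace ((t * M + s) / M)%nat with t
    by (rewrite Nat.add_comm, Nat.div_add, Nat.div_small; lia).
  1,2: destruct (Nat.eqb_spec i K) as [->|]; [|apply Hg; lia].
  1,2: assert (E : u K = - B + (u K + B) / (2 * B / INR M) * (2 * B / INR M)) by (field; lra);
    rewrite E; apply Rabs_le; split; nra.
  (* Here [c = K]: the coordinate vanishes on the slice and costs no further digit. *)
  exists (fun t i => if Nat.eqb i K then 0 else g t i).
  intros u Hu HuB; destruct (IH u Hu) as (t & Ht & Hg); [intros; apply HuB; lia|].
  exists t; split.
  - destruct (Nat.ltb_spec K K); try lia; destruct (Nat.ltb_spec K (S K)); try lia.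
    replace (S K - 1)%nat with K by lia; exact Ht.
  - intros i Hi; destruct (Nat.eqb_spec i K) as [->|]; [|apply Hg; lia].
    rewrite Hu, Rminus_0_r, Rabs_R0; lra.
Qed.

Lemma box_vol_cube k c r : box_vol k (fun i => c i - r) (fun i => c i + r) = (2 * r) ^ k.
Proof. induction k as [|k IH]; simpl; [reflexivity|]. rewrite IH; ring. Qed.

Lemma sumR_finite_le M C f s :
  0 <= s -> (forall n, (n < C)%nat -> f n <= s) -> (forall n, (C <= n)%nat -> f n <= 0) ->
  sumR M f <= INR C * s.
Proof.
  intros Hs H1 H2.
  apply Rle_trans with (INR (Nat.min M C) * s).
  - induction M as [|M IH]; [simpl; lra|]. cbn [sumR].
    destruct (Nat.lt_ge_cases M C) as [H|H].
    + rewrite Nat.min_l in * by lia. rewrite S_INR. specialize (H1 M H); lra.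
    + rewrite Nat.min_r in * by lia. specialize (H2 M H); lra.
  - apply Rmult_le_compat_r; [lra|]. apply le_INR; lia.
Qed.

(** At mesh [r = 2B/M] the slice has [M^(K-1)] cells, and the image of each lies in a cube of side
    [4Lr = 8LB/M]. The total volume is at most [(8LB)^K / M], which tends to 0. *)
Lemma null_lip_image K c B L (D : (nat -> R) -> Prop) (F : (nat -> R) -> nat -> R) :
  (c < K)%nat -> 0 < B -> 0 <= L ->
  (forall u, D u -> u c = 0 /\ forall i, (i < K)%nat -> Rabs (u i) <= B) ->
  (forall u v r, D u -> D v -> (forall i, (i < K)%nat -> Rabs (u i - v i) <= r) ->
     forall i, (i < K)%nat -> Rabs (F u i - F v i) <= L * r) ->
  lebesgue_null K (fun z => exists u, D u /\ forall i, (i < K)%nat -> z i = F u i).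
Proof.
  intros Hc HB HL HD HF eps He.
  destruct (INR_unbounded ((8 * L * B) ^ K / eps)) as [M0 HM0].
  set (M := S M0).
  assert (HM : (0 < M)%nat) by (unfold M; lia).
  assert (HM' : 0 < INR M) by now apply lt_0_INR.
  destruct (slice_grid M c B K HM HB) as [g Hg].
  set (r := 2 * B / INR M) in *.
  assert (Hr : 0 < r) by (apply Rdiv_lt_0_compat; lra).
  set (C := (M ^ (K - 1))%nat).
  set (near := fun t u => D u /\ forall i, (i < K)%nat -> Rabs (u i - g t i) <= r).
  (* The Lipschitz bound holds only on [D], so cubes are centred at the image of a point of [D] near
     the grid point, at distance at most [2 * r] from any other such point. If no such point exists,
     [epsilon] returns an arbitrary one, and the cube only adds to the volume. *)
  set (w := fun t => epsilon (inhabits (fun _ : nat => 0)) (near t)).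
  (* Beyond the [C] cells the cubes degenerate to points, of volume 0 because [0 < K]. *)
  set (rho := fun t => if Nat.ltb t C then L * (2 * r) else 0).
  assert (Hrho : forall t, 0 <= rho t).
  { intros t; unfold rho; destruct (Nat.ltb t C); [|lra]. apply Rmult_le_pos; lra. }
  exists (fun t i => F (w t) i - rho t), (fun t i => F (w t) i + rho t).
  split; [intros t i _; specialize (Hrho t); lra|]; split.
  - intros z (u & Hu & Hz).
    destruct (HD u Hu) as [Huc HuB].
    destruct (Hg u Huc HuB) as (t & Ht & Hut).
    destruct (Nat.ltb_spec c K); [|lia]. fold C in Ht.
    assert (Hw : near t (w t)).
    { apply epsilon_spec; exists u; split; assumption. }
    destruct Hw as [HwD Hw].
    exists t; intros i Hi; rewrite (Hz i Hi).
    assert (E : Rabs (F u i - F (w t) i) <= rho t).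
    { unfold rho; destruct (Nat.ltb_spec t C); [|lia].
      apply HF; auto. intros l Hl.
      replace (u l - w t l) with ((u l - g t l) + - (w t l - g t l)) by ring.
      eapply Rle_trans; [apply Rabs_triang|]; rewrite Rabs_Ropp.
      specialize (Hut l Hl); specialize (Hw l Hl); lra. }
    apply Rabs_bounds in E; lra.
  - intros m.
    assert (Hs : 0 <= 2 * (L * (2 * r))) by (apply Rmult_le_pos; [lra|apply Rmult_le_pos; lra]).
    eapply Rle_trans; [apply sumR_finite_le with (C := C) (s := (2 * (L * (2 * r))) ^ K)|].
    + apply pow_le, Hs.
    + intros t Ht; rewrite box_vol_cube; unfold rho.
      destruct (Nat.ltb_spec t C); [lra|lia].
    + intros t Ht; rewrite box_vol_cube; unfold rho.
      destruct (Nat.ltb_spec t C); [lia|]. rewrite Rmult_0_r, pow_i by lia; lra.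
    + unfold C; rewrite pow_INR.
      replace (2 * (L * (2 * r))) with (8 * L * B * / INR M) by (unfold r; field; lra).
      rewrite Rpow_mult_distr, pow_inv.
      replace (INR M ^ K) with (INR M ^ (K - 1) * INR M)
        by (rewrite Rmult_comm, tech_pow_Rmult; f_equal; lia).
      assert (0 < INR M ^ (K - 1)) by now apply pow_lt.
      replace (_ * _) with ((8 * L * B) ^ K / INR M) by (field; split; lra).
      apply (Rmult_le_reg_r (INR M)); [lra|].
      replace ((8 * L * B) ^ K / INR M * INR M) with ((8 * L * B) ^ K / eps * eps) by (field; lra).
      rewrite (Rmult_comm eps). apply Rmult_le_compat_r; [lra|].
      unfold M; rewrite S_INR; lra.
Qed.

(** * Sequential compactness and existence of minimisers *)

Lemma Un_cv_const c : Un_cv (fun _ => c) c.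
Proof. intros e He; exists O; intros n _. rewrite Rdist_eq; exact He. Qed.

Lemma Un_cv_subseq u l (phi : nat -> nat) :
  (forall n, (n <= phi n)%nat) -> Un_cv u l -> Un_cv (fun n => u (phi n)) l.
Proof.
  intros Hphi H e He; destruct (H e He) as [n0 Hn0]; exists n0; intros n Hn.
  apply Hn0; specialize (Hphi n); lia.
Qed.

Lemma Un_cv_inv_INR (u : nat -> R) l :
  (forall n, Rabs (u n - l) <= / INR (S n)) -> Un_cv u l.
Proof.
  intros H e He.
  destruct (inv_INR_small (e / 2)) as [n0 Hn0]; [lra|].
  exists n0; intros n Hn; unfold Rdist.
  assert (/ INR (S n) <= / INR (S n0)).
  { apply Rinv_le_contravar; [apply lt_0_INR; lia|apply le_INR; lia]. }
  specialize (H n); lra.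
Qed.

(** Subsequences are recorded through [n <= phi n], a condition that preserves limits and is stable
    under composition. The limit is a cluster value, approached within [1/(n+1)] at index
    [phi n]. *)
Lemma bounded_seq_cv_subseq (u : nat -> R) B :
  (forall n, Rabs (u n) <= B) ->
  exists l phi, (forall n, (n <= phi n)%nat) /\ Un_cv (fun n => u (phi n)) l.
Proof.
  intros H.
  destruct (Bolzano_Weierstrass u _ (compact_P3 (- B) B)) as [l Hl].
  { intros n; apply Rabs_bounds, H. }
  assert (C : forall n, {p | (n <= p)%nat /\ Rabs (u p - l) <= / INR (S n)}).
  { intros n; apply constructive_indefinite_description.
    assert (Hn : 0 < / INR (S n)) by (apply Rinv_0_lt_compat, lt_0_INR; lia).
    destruct (Hl (disc l (mkposreal _ Hn)) n) as (p & Hp & Hd).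
    { exists (mkposreal _ Hn); intros y Hy; exact Hy. }
    exists p; split; [exact Hp|]. unfold disc in Hd; cbn [pos] in Hd; lra. }
  exists l, (fun n => proj1_sig (C n)); split.
  - intros n; apply (proj2_sig (C n)).
  - apply Un_cv_inv_INR; intros n; apply (proj2_sig (C n)).
Qed.

Lemma bounded_vec_cv_subseq k (x : nat -> nat -> R) B :
  (forall n i, (i < k)%nat -> Rabs (x n i) <= B) ->
  exists l phi, (forall n, (n <= phi n)%nat) /\
    forall i, (i < k)%nat -> Un_cv (fun n => x (phi n) i) (l i).
Proof.
  intros H; induction k as [|k IH].
  { exists (fun _ => 0), (fun n => n); split; intros; lia. }
  destruct IH as (l & phi & Hphi & Hl); [intros; apply H; lia|].
  destruct (bounded_seq_cv_subseq (fun n => x (phi n) k) B) as (l' & psi & Hpsi & Hl').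
  { intros; apply H; lia. }
  exists (fun i => if Nat.eqb i k then l' else l i), (fun n => phi (psi n)); split.
  - intros n; specialize (Hphi (psi n)); specialize (Hpsi n); lia.
  - intros i Hi; destruct (Nat.eqb_spec i k) as [->|]; [exact Hl'|].
    apply (Un_cv_subseq (fun n => x (phi n) i)); [exact Hpsi|apply Hl; lia].
Qed.

(** Continuity on [R^k] for points encoded as functions on [nat]: convergence is required of the
    first [k] coordinates only. *)
Definition seq_cont (k : nat) (f : (nat -> R) -> R) : Prop :=
  forall (x : nat -> nat -> R) l,
    (forall i, (i < k)%nat -> Un_cv (fun n => x n i) (l i)) ->
    Un_cv (fun n => f (x n)) (f l).

Lemma seq_cont_const k c : seq_cont k (fun _ => c).
Proof. intros x l _; apply Un_cv_const. Qed.

Lemma seq_cont_proj k i : (i < k)%nat -> seq_cont k (fun x => x i).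
Proof. intros Hi x l H; exact (H i Hi). Qed.

Lemma seq_cont_plus k f g :
  seq_cont k f -> seq_cont k g -> seq_cont k (fun x => f x + g x).
Proof. intros Hf Hg x l H; apply CV_plus; auto. Qed.

Lemma seq_cont_mult k f g :
  seq_cont k f -> seq_cont k g -> seq_cont k (fun x => f x * g x).
Proof. intros Hf Hg x l H; apply CV_mult; auto. Qed.

Lemma seq_cont_minus k f g :
  seq_cont k f -> seq_cont k g -> seq_cont k (fun x => f x - g x).
Proof. intros Hf Hg x l H; apply CV_minus; auto. Qed.

Lemma seq_cont_comp k f g :
  continuity g -> seq_cont k f -> seq_cont k (fun x => g (f x)).
Proof. intros Hg Hf x l H; apply continuity_seq; [apply Hg|apply Hf, H]. Qed.

Lemma seq_cont_sum k n (f : nat -> (nat -> R) -> R) :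
  (forall i, (i < n)%nat -> seq_cont k (f i)) ->
  seq_cont k (fun x => sumR n (fun i => f i x)).
Proof.
  intros H; induction n as [|n IH]; simpl; [apply seq_cont_const|].
  apply seq_cont_plus; [apply IH; intros; apply H|apply H]; lia.
Qed.

(** Direct method: a minimising sequence is bounded, a subsequence converges, closedness keeps the
    limit in [P], and continuity of [f] passes to the limit. *)
Lemma attains_min k (P : (nat -> R) -> Prop) f B c :
  (exists x, P x) ->
  (forall x i, P x -> (i < k)%nat -> Rabs (x i) <= B) ->
  (forall x l, (forall n, P (x n)) ->
     (forall i, (i < k)%nat -> Un_cv (fun n => x n i) (l i)) -> P l) ->
  (forall x, P x -> c <= f x) -> seq_cont k f ->
  exists x, P x /\ forall x', P x' -> f x <= f x'.
Proof.
  intros [x0 Hx0] HB Hcl Hc Hf.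
  (* The infimum of [f] is obtained as [- M], with [M] the supremum of [- f]. *)
  destruct (completeness (fun r => exists x, P x /\ r = - f x)) as [M [HM1 HM2]].
  - exists (- c); intros r (x & Hx & ->); specialize (Hc x Hx); lra.
  - exists (- f x0), x0; auto.
  - assert (C : forall n, {x | P x /\ f x <= - M + / INR (S n)}).
    { intros n; apply constructive_indefinite_description; apply NNPP; intros Hno.
      assert (Hn : 0 < / INR (S n)) by (apply Rinv_0_lt_compat, lt_0_INR; lia).
      enough (M <= M - / INR (S n)) by lra.
      apply HM2; intros r (x & Hx & ->).
      destruct (Rle_dec (f x) (- M + / INR (S n))); [exfalso; eauto|lra]. }
    destruct (bounded_vec_cv_subseq k (fun n => proj1_sig (C n)) B) as (l & phi & Hphi & Hl).
    { intros n i Hi; apply HB; [apply (proj2_sig (C n))|exact Hi]. }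
    exists l; split; [apply (Hcl _ l (fun n => proj1 (proj2_sig (C (phi n)))) Hl)|].
    intros x' Hx'.
    assert (HM : - M <= f x') by (specialize (HM1 (- f x')); enough (- f x' <= M) by lra; eauto).
    enough (f l <= - M) by lra.
    apply Rle_cv_lim with (fun n => f (proj1_sig (C (phi n)))) (fun n => - M + / INR (S n)).
    + intros n; eapply Rle_trans; [apply (proj2_sig (C (phi n)))|].
      apply Rplus_le_compat_l, Rinv_le_contravar; [apply lt_0_INR; lia|].
      apply le_INR; specialize (Hphi n); lia.
    + apply Hf, Hl.
    + apply Un_cv_inv_INR; intros n.
      replace (- M + / INR (S n) - - M) with (/ INR (S n)) by ring.
      rewrite Rabs_pos_eq; [lra|]. left; apply Rinv_0_lt_compat, lt_0_INR; lia.
Qed.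

(** * Real powers, signed powers and strict convexity of [|t|^r] *)

Lemma rpow0_npos s q : s <= 0 -> rpow0 s q = 0.
Proof. intros H; unfold rpow0; destruct (Rle_dec s 0); [reflexivity|lra]. Qed.

Lemma rpow0_pos s q : 0 < s -> rpow0 s q = Rpower s q.
Proof. intros H; unfold rpow0; destruct (Rle_dec s 0); [lra|reflexivity]. Qed.

Lemma Rpower_gt0 s q : 0 < Rpower s q.
Proof. apply exp_pos. Qed.

Lemma rpow0_gt0 s q : 0 < s -> 0 < rpow0 s q.
Proof. intros H; rewrite rpow0_pos by exact H; apply Rpower_gt0. Qed.

Lemma rpow0_ge0 s q : 0 <= rpow0 s q.
Proof.
  destruct (Rle_lt_dec s 0) as [H|H]; [rewrite rpow0_npos; lra|].
  left; now apply rpow0_gt0.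
Qed.

Lemma rpow0_lt s t q : 0 < q -> s < t -> 0 < t -> rpow0 s q < rpow0 t q.
Proof.
  intros Hq Hst Ht; destruct (Rle_lt_dec s 0) as [H|H].
  - rewrite (rpow0_npos s) by exact H; now apply rpow0_gt0.
  - rewrite !rpow0_pos by lra; apply Rlt_Rpower_l; lra.
Qed.

Lemma rpow0_le s t q : 0 < q -> s <= t -> rpow0 s q <= rpow0 t q.
Proof.
  intros Hq Hst; destruct (Rle_lt_dec t 0) as [H|H]; [rewrite !rpow0_npos; lra|].
  destruct (Req_dec s t) as [->|]; [lra|]. left; apply rpow0_lt; lra.
Qed.

Lemma rpow0_mult s a b : 0 < s -> rpow0 (rpow0 s a) b = rpow0 s (a * b).
Proof.
  intros Hs; rewrite (rpow0_pos (rpow0 s a)) by now apply rpow0_gt0.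
  rewrite !rpow0_pos by exact Hs; apply Rpower_mult.
Qed.

Lemma rpow0_1 s : 0 < s -> rpow0 s 1 = s.
Proof. intros Hs; rewrite rpow0_pos by exact Hs; now apply Rpower_1. Qed.

Lemma derivable_pt_lim_rpow0 r t :
  1 < r -> derivable_pt_lim (fun s => rpow0 s r) t (r * rpow0 t (r - 1)).
Proof.
  intros Hr; destruct (Rtotal_order t 0) as [Ht|[->|Ht]].
  - rewrite rpow0_npos, Rmult_0_r by lra.
    apply derivable_pt_lim_locally_ext with (fct_cte 0) (t - 1) 0.
    + lra.
    + intros z Hz; unfold fct_cte; rewrite rpow0_npos; lra.
    + apply derivable_pt_lim_const.
  - rewrite !(rpow0_npos 0), Rmult_0_r by lra. intros e He.
    (* At 0 the difference quotient is [h^(r-1)] for [h > 0] and 0 for [h < 0]; this [d] solves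
       [d^(r-1) = e]. *)
    set (d := Rpower e (/ (r - 1))).
    assert (Hd : 0 < d) by apply Rpower_gt0.
    exists (mkposreal d Hd); intros h Hh Hhd; cbn [pos] in Hhd.
    rewrite Rplus_0_l, (rpow0_npos 0), !Rminus_0_r by lra.
    destruct (Rle_lt_dec h 0) as [H|H].
    { rewrite rpow0_npos by exact H; unfold Rdiv; rewrite Rmult_0_l, Rabs_R0; exact He. }
    rewrite Rabs_pos_eq in Hhd by lra.
    rewrite rpow0_pos by exact H.
    replace (Rpower h r) with (Rpower h (r - 1) * h).
    2:{ rewrite <- (Rpower_1 h H) at 2; rewrite <- Rpower_plus; f_equal; ring. }
    replace (Rpower h (r - 1) * h / h) with (Rpower h (r - 1)) by (field; lra).
    rewrite Rabs_pos_eq by (left; apply Rpower_gt0).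
    replace e with (Rpower d (r - 1)); [apply Rlt_Rpower_l; lra|].
    unfold d; rewrite Rpower_mult, Rinv_l by lra. now apply Rpower_1.
  - rewrite rpow0_pos by exact Ht.
    apply derivable_pt_lim_locally_ext with (fun s => Rpower s r) 0 (t + 1).
    + lra.
    + intros z Hz; rewrite rpow0_pos; lra.
    + now apply derivable_pt_lim_power.
Qed.

(* [sign t * |t|^q] *)
Definition spow (q t : R) : R := rpow0 t q - rpow0 (- t) q.

Lemma spow_pos q t : 0 < t -> spow q t = rpow0 t q.
Proof. intros H; unfold spow; rewrite (rpow0_npos (- t)); lra. Qed.

Lemma spow_neg q t : t < 0 -> spow q t = - rpow0 (- t) q.
Proof. intros H; unfold spow; rewrite (rpow0_npos t); lra. Qed.

Lemma spow_0 q : spow q 0 = 0.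
Proof. unfold spow; rewrite Ropp_0; lra. Qed.

Lemma spow_neq0 q t : t <> 0 -> spow q t <> 0.
Proof.
  intros H; destruct (Rdichotomy t 0 H) as [Ht|Ht].
  - rewrite spow_neg by exact Ht; assert (0 < rpow0 (- t) q) by (apply rpow0_gt0; lra); lra.
  - rewrite spow_pos by exact Ht; assert (0 < rpow0 t q) by now apply rpow0_gt0. lra.
Qed.

Lemma spow_lt q s t : 0 < q -> s < t -> spow q s < spow q t.
Proof.
  intros Hq Hst; unfold spow.
  pose proof (rpow0_le s t q Hq ltac:(lra)).
  pose proof (rpow0_le (- t) (- s) q Hq ltac:(lra)).
  destruct (Rle_lt_dec t 0) as [Ht|Ht].
  - pose proof (rpow0_lt (- t) (- s) q Hq ltac:(lra) ltac:(lra)); lra.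
  - pose proof (rpow0_lt s t q Hq ltac:(lra) ltac:(lra)); lra.
Qed.

(** Used with exponents [p - 1] and [1/(p-1)], to pass between the primal vector and the
    multiplier. *)
Lemma spow_spow a b t : a * b = 1 -> spow b (spow a t) = t.
Proof.
  intros Hab; destruct (Rtotal_order t 0) as [Ht|[->|Ht]].
  - rewrite (spow_neg a) by exact Ht.
    assert (0 < rpow0 (- t) a) by (apply rpow0_gt0; lra).
    rewrite spow_neg, Ropp_involutive, rpow0_mult, Hab, rpow0_1 by lra; ring.
  - now rewrite !spow_0.
  - rewrite (spow_pos a) by exact Ht.
    assert (0 < rpow0 t a) by (apply rpow0_gt0; lra).
    rewrite spow_pos, rpow0_mult, Hab, rpow0_1 by lra; reflexivity.
Qed.

(** One of the two summands always vanishes, so differentiability of [|t|^r], also at 0, reduces to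
    that of [rpow0]. *)
Lemma rpow0_Rabs t r : rpow0 (Rabs t) r = rpow0 t r + rpow0 (- t) r.
Proof.
  destruct (Rle_lt_dec t 0) as [Ht|Ht].
  - rewrite (rpow0_npos t), Rabs_left1 by lra; lra.
  - rewrite (rpow0_npos (- t)), Rabs_pos_eq by lra; lra.
Qed.

Lemma derivable_pt_lim_abs_pow r t :
  1 < r -> derivable_pt_lim (fun s => rpow0 (Rabs s) r) t (r * spow (r - 1) t).
Proof.
  intros Hr.
  apply derivable_pt_lim_ext with
    ((fun s => rpow0 s r) + comp (fun s => rpow0 s r) (- id))%F.
  { intros s; unfold plus_fct, comp, opp_fct, id; now rewrite rpow0_Rabs. }
  replace (r * spow (r - 1) t) with
    (r * rpow0 t (r - 1) + r * rpow0 (- t) (r - 1) * - 1) by (unfold spow; ring).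
  apply derivable_pt_lim_plus; [now apply derivable_pt_lim_rpow0|].
  apply derivable_pt_lim_comp; [apply derivable_pt_lim_opp, derivable_pt_lim_id|].
  now apply derivable_pt_lim_rpow0.
Qed.

Lemma abs_pow_continuity r : 1 < r -> continuity (fun s => rpow0 (Rabs s) r).
Proof.
  intros Hr t; apply derivable_continuous_pt.
  exists (r * spow (r - 1) t); now apply derivable_pt_lim_abs_pow.
Qed.

(** Strict convexity: by the mean value theorem the chord slope is a value of the derivative
    strictly between [a] and [b], and the derivative is strictly increasing. *)
Lemma abs_pow_tangent_lt r a b : 1 < r -> a <> b ->
  rpow0 (Rabs a) r + r * spow (r - 1) a * (b - a) < rpow0 (Rabs b) r.
Proof.
  intros Hr Hab; destruct (Rdichotomy a b Hab) as [H|H].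
  - destruct (MVT_cor2 (fun s => rpow0 (Rabs s) r) (fun s => r * spow (r - 1) s) a b H)
      as (c & Hc & Hac); [intros; now apply derivable_pt_lim_abs_pow|].
    pose proof (spow_lt (r - 1) a c ltac:(lra) ltac:(lra)).
    assert (0 < r * (spow (r - 1) c - spow (r - 1) a) * (b - a)); [|cbv beta in Hc; lra].
    apply Rmult_lt_0_compat; [apply Rmult_lt_0_compat|]; lra.
  - destruct (MVT_cor2 (fun s => rpow0 (Rabs s) r) (fun s => r * spow (r - 1) s) b a H)
      as (c & Hc & Hac); [intros; now apply derivable_pt_lim_abs_pow|].
    pose proof (spow_lt (r - 1) c a ltac:(lra) ltac:(lra)).
    assert (0 < r * (spow (r - 1) a - spow (r - 1) c) * (a - b)); [|cbv beta in Hc; lra].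
    apply Rmult_lt_0_compat; [apply Rmult_lt_0_compat|]; lra.
Qed.

Lemma abs_pow_tangent r a b : 1 < r ->
  rpow0 (Rabs a) r + r * spow (r - 1) a * (b - a) <= rpow0 (Rabs b) r.
Proof.
  intros Hr; destruct (Req_dec a b) as [->|H]; [|left; now apply abs_pow_tangent_lt].
  lra.
Qed.

Lemma abs_pow_superlinear r K : 1 < r ->
  exists C, forall t, K * Rabs t - C <= rpow0 (Rabs t) r.
Proof.
  (* The tangent of [|t|^r] at [a] has slope [K]; [C] is minus its intercept. *)
  intros Hr; set (a := spow (/ (r - 1)) (K / r)).
  exists (K * a - rpow0 (Rabs a) r); intros t.
  pose proof (abs_pow_tangent r a (Rabs t) Hr) as H.
  rewrite Rabs_Rabsolu in H.
  unfold a in H at 2; rewrite spow_spow in H by (field; lra).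
  replace (r * (K / r)) with K in H by (field; lra). lra.
Qed.

(** * The dual problem *)

(** Coordinate [j] of [A^T l], that is, the inner product of column [j] with [l]. *)
Definition tmul (m : nat) (A : nat -> nat -> R) (l : nat -> R) (j : nat) : R :=
  sumR m (fun i => A i j * l i).

Definition tinj (m N : nat) (A : nat -> nat -> R) : Prop :=
  forall l, (forall j, (j < N)%nat -> tmul m A l j = 0) -> forall i, (i < m)%nat -> l i = 0.

Lemma tmul_scal m A l c j : tmul m A (fun i => c * l i) j = c * tmul m A l j.
Proof. unfold tmul; rewrite <- sumR_scal; apply sumR_ext; intros; ring. Qed.

Lemma seq_cont_tmul m A j : seq_cont m (fun l => tmul m A l j).
Proof.
  apply (seq_cont_sum m m (fun i l => A i j * l i)); intros i Hi.
  apply seq_cont_mult; [apply seq_cont_const|now apply seq_cont_proj].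
Qed.

Lemma seq_cont_l1 m : seq_cont m (fun l => sumR m (fun i => Rabs (l i))).
Proof.
  apply (seq_cont_sum m m (fun i l => Rabs (l i))); intros i Hi.
  apply seq_cont_comp; [apply Rcontinuity_abs|now apply seq_cont_proj].
Qed.

Lemma l1_bound m l i : (i < m)%nat -> Rabs (l i) <= sumR m (fun i => Rabs (l i)).
Proof.
  intros Hi; apply (sumR_term_le m (fun i => Rabs (l i))); [|exact Hi].
  intros; apply Rabs_pos.
Qed.

(** The constant is the minimum of the l1 norm of [A^T l] over the compact l1 unit sphere;
    injectivity makes it positive and homogeneity extends the bound to all [l]. *)
Lemma tmul_coercive m N A :
  (1 <= m)%nat -> tinj m N A ->
  exists c, 0 < c /\
    forall l, c * sumR m (fun i => Rabs (l i)) <= sumR N (fun j => Rabs (tmul m A l j)).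
Proof.
  intros Hm Hinj.
  destruct (attains_min m (fun l => sumR m (fun i => Rabs (l i)) = 1)
    (fun l => sumR N (fun j => Rabs (tmul m A l j))) 1 0) as (mu & Hmu & Hmin).
  - exists (fun i => if Nat.eqb i 0 then 1 else 0).
    rewrite (sumR_remove m 0), (sumR_ext m _ (fun _ => 0)), sumR_zero; [|intros i Hi|lia].
    + simpl; rewrite Rabs_R1; ring.
    + destruct (Nat.eqb i 0); [reflexivity|apply Rabs_R0].
  - intros l i <- Hi; now apply l1_bound.
  - intros x l Hx Hl; apply seq_cont_l1 in Hl.
    apply (UL_sequence _ _ _ Hl), Un_cv_ext with (fun _ => 1); [intros; now rewrite Hx|].
    apply Un_cv_const.
  - intros l _; apply sumR_nonneg; intros; apply Rabs_pos.
  - apply (seq_cont_sum m N (fun j l => Rabs (tmul m A l j))); intros j _.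
    apply seq_cont_comp; [apply Rcontinuity_abs|apply seq_cont_tmul].
  - set (c := sumR N (fun j => Rabs (tmul m A mu j))) in *.
    exists c; split.
    + apply Rnot_le_lt; intros Hc.
      assert (H0 : forall i, (i < m)%nat -> mu i = 0).
      { apply Hinj; intros j Hj; apply NNPP; intros Hne; apply Rabs_no_R0 in Hne; apply Hne.
        apply (sumR_eq0 N (fun j => Rabs (tmul m A mu j))); [intros; apply Rabs_pos|exact Hc|exact Hj]. }
      rewrite (sumR_ext m _ (fun _ => 0)), sumR_zero in Hmu; [lra|].
      intros i Hi; rewrite H0, Rabs_R0 by exact Hi; reflexivity.
    + intros l; set (n := sumR m (fun i => Rabs (l i))).
      assert (Hn : 0 <= n) by (apply sumR_nonneg; intros; apply Rabs_pos).
      destruct (Req_dec n 0) as [->|Hn0].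
      { rewrite Rmult_0_r; apply sumR_nonneg; intros; apply Rabs_pos. }
      assert (Hi : 0 < / n) by (apply Rinv_0_lt_compat; lra).
      specialize (Hmin (fun i => / n * l i)); cbv beta in Hmin.
      rewrite (sumR_ext m _ (fun i => / n * Rabs (l i))) in Hmin
        by (intros; rewrite Rabs_mult, (Rabs_pos_eq (/ n)); [reflexivity|lra]).
      rewrite (sumR_ext N _ (fun j => / n * Rabs (tmul m A l j))) in Hmin
        by (intros; rewrite tmul_scal, Rabs_mult, (Rabs_pos_eq (/ n)); [reflexivity|lra]).
      rewrite !sumR_scal in Hmin. fold n in Hmin.
      specialize (Hmin ltac:(field; lra)).
      apply (Rmult_le_compat_r n) in Hmin; [|exact Hn].
      replace (/ n * sumR N (fun j => Rabs (tmul m A l j)) * n)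
        with (sumR N (fun j => Rabs (tmul m A l j))) in Hmin by (field; lra).
      exact Hmin.
Qed.

Lemma derivable_pt_lim_sumR n (f : nat -> R -> R) f' t :
  (forall i, (i < n)%nat -> derivable_pt_lim (f i) t (f' i)) ->
  derivable_pt_lim (fun s => sumR n (fun i => f i s)) t (sumR n f').
Proof.
  intros H; induction n as [|n IH]; simpl; [apply derivable_pt_lim_const|].
  apply (derivable_pt_lim_plus (fun s => sumR n (fun i => f i s)) (f n));
    [apply IH; intros; apply H|apply H]; lia.
Qed.

Lemma derivable_pt_lim_min f t f' :
  derivable_pt_lim f t f' -> (forall s, f t <= f s) -> f' = 0.
Proof.
  intros Hf Hmin.
  rewrite <- (deriv_minimum f (t - 1) (t + 1) t (exist _ f' Hf)); try lra; auto.
Qed.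

Lemma derivable_pt_lim_affine a b t : derivable_pt_lim (fun s => a + b * s) t b.
Proof.
  assert (H : derivable_pt_lim (fct_cte a + mult_real_fct b id) t (0 + b * 1)).
  { apply derivable_pt_lim_plus; [apply derivable_pt_lim_const|].
    apply derivable_pt_lim_scal, derivable_pt_lim_id. }
  rewrite Rplus_0_l, Rmult_1_r in H; exact H.
Qed.

Definition shift (l : nat -> R) (k : nat) (s : R) (i : nat) : R :=
  if Nat.eqb i k then l i + s else l i.

Lemma sumR_shift m (a l : nat -> R) k s : (k < m)%nat ->
  sumR m (fun i => a i * shift l k s i) = sumR m (fun i => a i * l i) + a k * s.
Proof.
  intros Hk; rewrite (sumR_remove m k _ Hk), (sumR_remove m k (fun i => a i * l i) Hk).
  unfold shift at 1; rewrite Nat.eqb_refl.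
  rewrite (sumR_ext m _ (fun i => if Nat.eqb i k then 0 else a i * l i)); [ring|].
  intros i _; unfold shift; destruct (Nat.eqb i k); reflexivity.
Qed.

(* The minimiser of the dual functional [sum_j |(A^T l)_j|^r - r <y, l>]
   is the Lagrange multiplier of the primal problem. *)
Lemma dual_solution r m N A y :
  1 < r -> (1 <= m)%nat -> tinj m N A ->
  exists l, feasible m N A y (fun j => spow (r - 1) (tmul m A l j)).
Proof.
  intros Hr Hm Hinj.
  destruct (tmul_coercive m N A Hm Hinj) as (c & Hc & Hcoer).
  set (f := fun l => sumR N (fun j => rpow0 (Rabs (tmul m A l j)) r)
                     - sumR m (fun i => r * y i * l i)).
  set (Y := sumR m (fun i => Rabs (r * y i))).
  assert (HY : 0 <= Y) by (apply sumR_nonneg; intros; apply Rabs_pos).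
  (* With slope [(Y + 1) / c] the power sum is at least [(Y + 1) * n - INR N * C], where [n] is the
     l1 norm of [l]. The linear term is at most [Y * n], so [f l] is at least [n - INR N * C]. *)
  destruct (abs_pow_superlinear r ((Y + 1) / c) Hr) as [C HC].
  assert (Hlow : forall l, sumR m (fun i => Rabs (l i)) - INR N * C <= f l).
  { intros l; unfold f; set (n := sumR m (fun i => Rabs (l i))).
    assert (Hn : 0 <= n) by (apply sumR_nonneg; intros; apply Rabs_pos).
    assert (H1 : sumR N (fun j => (Y + 1) / c * Rabs (tmul m A l j) - C)
                 <= sumR N (fun j => rpow0 (Rabs (tmul m A l j)) r))
      by (apply sumR_le; intros; apply HC).
    rewrite sumR_minus, sumR_scal, sumR_const in H1.
    assert (H2 : (Y + 1) / c * (c * n) <= (Y + 1) / c * sumR N (fun j => Rabs (tmul m A l j))).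
    { apply Rmult_le_compat_l; [apply Rle_mult_inv_pos; [lra|exact Hc]|apply Hcoer]. }
    replace ((Y + 1) / c * (c * n)) with (Y * n + n) in H2 by (field; lra).
    assert (H3 : sumR m (fun i => r * y i * l i) <= Y * n).
    { eapply Rle_trans; [apply Rle_abs|]; eapply Rle_trans; [apply sumR_abs|].
      unfold Y; rewrite Rmult_comm, <- sumR_scal; apply sumR_le; intros i Hi.
      rewrite Rabs_mult, Rmult_comm; apply Rmult_le_compat_r; [apply Rabs_pos|].
      now apply l1_bound. }
    lra. }
  assert (Hf0 : f (fun _ => 0) = 0).
  { unfold f; rewrite (sumR_ext N _ (fun _ => 0)), (sumR_ext m _ (fun _ => 0)), !sumR_zero.
    - ring.
    - intros; ring.
    - intros j _; rewrite rpow0_npos; [reflexivity|].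
      unfold tmul; rewrite (sumR_ext m _ (fun _ => 0)), sumR_zero, Rabs_R0; [lra|].
      intros; ring. }
  assert (HNC : 0 <= INR N * C).
  { specialize (Hlow (fun _ => 0)). rewrite (sumR_ext m _ (fun _ => 0)), sumR_zero in Hlow; [lra|].
    intros; apply Rabs_R0. }
  (* Outside the l1 ball of radius [INR N * C] the lower bound gives [f > 0 = f 0], so a minimiser
     on this ball is global. *)
  destruct (attains_min m (fun l => sumR m (fun i => Rabs (l i)) <= INR N * C)
    f (INR N * C) (- (INR N * C))) as (l & Hl & Hmin).
  - exists (fun _ => 0). rewrite (sumR_ext m _ (fun _ => 0)), sumR_zero; [exact HNC|].
    intros; apply Rabs_R0.
  - intros l i Hl Hi; exact (Rle_trans _ _ _ (l1_bound m l i Hi) Hl).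
  - intros x l Hx Hl; apply seq_cont_l1 in Hl.
    apply (Rle_cv_lim Hx Hl), Un_cv_const.
  - intros l _; eapply Rle_trans; [|apply Hlow].
    assert (0 <= sumR m (fun i => Rabs (l i))) by (apply sumR_nonneg; intros; apply Rabs_pos).
    lra.
  - apply seq_cont_minus.
    + apply (seq_cont_sum m N (fun j l => rpow0 (Rabs (tmul m A l j)) r)); intros j _.
      apply (seq_cont_comp m (fun l => tmul m A l j) (fun t => rpow0 (Rabs t) r)); [now apply abs_pow_continuity|].
      apply seq_cont_tmul.
    + apply (seq_cont_sum m m (fun i l => r * y i * l i)); intros i Hi.
      apply seq_cont_mult; [apply seq_cont_const|now apply seq_cont_proj].
  - assert (Hglob : forall l', f l <= f l').
    { intros l'; destruct (Rle_lt_dec (sumR m (fun i => Rabs (l' i))) (INR N * C)) as [H|H].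
      - now apply Hmin.
      - apply Rle_trans with 0; [|specialize (Hlow l'); lra].
        rewrite <- Hf0; apply Hmin.
        rewrite (sumR_ext m _ (fun _ => 0)), sumR_zero; [exact HNC|]. intros; apply Rabs_R0. }
    exists l; intros k Hk.
    (* The left side is the partial derivative of [f] at [l] in direction [k], equal to [r] times
       the residual of equation [k]. *)
    enough (E : sumR N (fun j => r * spow (r - 1) (tmul m A l j) * A k j) - r * y k = 0).
    { rewrite (sumR_ext N _ (fun j => r * (A k j * spow (r - 1) (tmul m A l j)))), sumR_scal in E
        by (intros; ring).
      apply (Rmult_eq_reg_l r); lra. }
    set (g := fun s => sumR N (fun j => rpow0 (Rabs (tmul m A l j + A k j * s)) r)
                       - (sumR m (fun i => r * y i * l i) + r * y k * s)).
    assert (Hg : forall s, g s = f (shift l k s)).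
    { intros s; unfold f, g; rewrite (sumR_shift m (fun i => r * y i)) by exact Hk.
      f_equal; apply sumR_ext; intros j _; unfold tmul.
      now rewrite (sumR_shift m (fun i => A i j)) by exact Hk. }
    assert (Hg0 : g 0 = f l).
    { unfold f, g. f_equal; [apply sumR_ext; intros j _; do 2 f_equal|]; ring. }
    apply (derivable_pt_lim_min g 0); [|intros s; rewrite Hg0, Hg; apply Hglob].
    apply (derivable_pt_lim_minus (fun s => sumR N (fun j => rpow0 (Rabs (tmul m A l j + A k j * s)) r))
      (fun s => sumR m (fun i => r * y i * l i) + r * y k * s)); [|apply derivable_pt_lim_affine].
    apply (derivable_pt_lim_sumR N (fun j s => rpow0 (Rabs (tmul m A l j + A k j * s)) r)).
    intros j _.
    pose proof (derivable_pt_lim_comp (fun s => tmul m A l j + A k j * s)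
      (fun t => rpow0 (Rabs t) r) 0 _ _
      (derivable_pt_lim_affine _ _ _) (derivable_pt_lim_abs_pow r _ Hr)) as H.
    rewrite Rmult_0_r, Rplus_0_r in H; exact H.
Qed.

(** * From a multiplier to the unique optimal solution *)

Lemma tmul_pairing m N A l x :
  sumR N (fun j => tmul m A l j * x j) = sumR m (fun i => l i * sumR N (fun j => A i j * x j)).
Proof.
  rewrite (sumR_ext N _ (fun j => sumR m (fun i => l i * (A i j * x j)))).
  - rewrite sumR_swap; apply sumR_ext; intros; apply sumR_scal.
  - intros j _; unfold tmul; rewrite Rmult_comm, <- sumR_scal; apply sumR_ext; intros; ring.
Qed.

Lemma pnorm_le_iff p N x x' : 0 < p ->
  pnorm p N x <= pnorm p N x' <->
  sumR N (fun i => rpow0 (Rabs (x i)) p) <= sumR N (fun i => rpow0 (Rabs (x' i)) p).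
Proof.
  intros Hp; unfold pnorm.
  assert (Hq : 0 < 1 / p) by (apply Rdiv_lt_0_compat; lra).
  split; intros H; [|now apply rpow0_le].
  apply Rnot_lt_le; intros Hlt.
  assert (H' : rpow0 (sumR N (fun i => rpow0 (Rabs (x' i)) p)) (1 / p) <
               rpow0 (sumR N (fun i => rpow0 (Rabs (x i)) p)) (1 / p)); [|lra].
  apply rpow0_lt; [exact Hq|exact Hlt|].
  eapply Rle_lt_trans; [|exact Hlt]. apply sumR_nonneg; intros; apply rpow0_ge0.
Qed.

(** The gradient at [x] is [p A^T l], orthogonal to [x' - x] for every feasible [x']. Hence the
    remainders [gap] of the tangent inequality add up to the difference of the p-th power sums. They
    are nonnegative, which gives optimality; a zero sum kills each of them, and strictness then
    forces equality of coordinates. *)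
Lemma multiplier_optimal p m N A y l x :
  1 < p -> feasible m N A y x ->
  (forall j, (j < N)%nat -> spow (p - 1) (x j) = tmul m A l j) ->
  optimal p m N A y x /\
  forall x', optimal p m N A y x' -> forall i, (i < N)%nat -> x' i = x i.
Proof.
  intros Hp Hx Hl.
  set (gap := fun (x' : nat -> R) j => rpow0 (Rabs (x' j)) p - rpow0 (Rabs (x j)) p
                        - p * spow (p - 1) (x j) * (x' j - x j)).
  assert (Hgap : forall x', feasible m N A y x' -> sumR N (gap x') =
    sumR N (fun j => rpow0 (Rabs (x' j)) p) - sumR N (fun j => rpow0 (Rabs (x j)) p)).
  { intros x' Hx'; unfold gap; rewrite !sumR_minus.
    enough (E : sumR N (fun j => p * spow (p - 1) (x j) * (x' j - x j)) = 0) by (rewrite E; ring).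
    rewrite (sumR_ext N _ (fun j => p * (tmul m A l j * x' j - tmul m A l j * x j)))
      by (intros j Hj; rewrite Hl by exact Hj; ring).
    rewrite sumR_scal, sumR_minus, !tmul_pairing.
    rewrite (sumR_ext m (fun i => l i * sumR N (fun j => A i j * x' j)) (fun i => l i * y i))
      by (intros; rewrite Hx' by assumption; reflexivity).
    rewrite (sumR_ext m (fun i => l i * sumR N (fun j => A i j * x j)) (fun i => l i * y i))
      by (intros; rewrite Hx by assumption; reflexivity).
    ring. }
  assert (Hpos : forall x' j, 0 <= gap x' j).
  { intros x' j; unfold gap. pose proof (abs_pow_tangent p (x j) (x' j) Hp); lra. }
  split.
  - split; [exact Hx|]. intros x' Hx'; apply pnorm_le_iff; [lra|].
    specialize (Hgap x' Hx').
    assert (0 <= sumR N (gap x')) by (apply sumR_nonneg; intros; apply Hpos). lra.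
  - intros x' [Hx' Hopt] i Hi.
    specialize (Hopt x Hx); apply pnorm_le_iff in Hopt; [|lra].
    specialize (Hgap x' Hx').
    assert (E : gap x' i = 0) by (apply (sumR_eq0 N (gap x')); [intros; apply Hpos|lra|exact Hi]).
    apply NNPP; intros Hne; unfold gap in E.
    pose proof (abs_pow_tangent_lt p (x i) (x' i) Hp ltac:(congruence)); lra.
Qed.

Lemma supp_size_full N x : (forall i, (i < N)%nat -> x i <> 0) -> supp_size N x = N.
Proof.
  induction N as [|N IH]; intros H; simpl; [reflexivity|].
  rewrite IH by (intros; apply H; lia).
  destruct (Req_EM_T (x N) 0) as [E|_]; [exfalso; apply (H N); [lia|exact E]|lia].
Qed.

(** If no inner product of a column with the dual minimiser vanished, the associated primal vector
    would be the unique optimum with full support. *)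
Lemma not_good_multiplier p m N A y :
  1 < p -> (1 <= m)%nat -> tinj m N A -> ~ good p m N A y ->
  exists l j, (j < N)%nat /\ tmul m A l j = 0 /\
    feasible m N A y (fun j => spow (/ (p - 1)) (tmul m A l j)).
Proof.
  intros Hp Hm Hinj Hbad.
  assert (Hq : 0 < / (p - 1)) by (apply Rinv_0_lt_compat; lra).
  destruct (dual_solution (1 + / (p - 1)) m N A y ltac:(lra) Hm Hinj) as [l Hl].
  replace (1 + / (p - 1) - 1) with (/ (p - 1)) in Hl by ring.
  exists l; apply NNPP; intros Hno; apply Hbad.
  eexists; split; [|split].
  1,2: apply (multiplier_optimal p m N A y l); [exact Hp|exact Hl|].
  1,2: intros j _; apply spow_spow; field; lra.
  apply supp_size_full; intros j Hj; apply spow_neq0; intros E.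
  apply Hno; exists j; auto.
Qed.

(** * Calculus of bounded Lipschitz functions *)

(** Lipschitz for the sup distance on the first [K] coordinates. The bound on [f] is included so
    that the class is closed under products. *)
Definition lip (K : nat) (D : (nat -> R) -> Prop) (f : (nat -> R) -> R) : Prop :=
  exists L B, 0 <= L /\ 0 <= B /\ (forall u, D u -> Rabs (f u) <= B) /\
    forall u v r, D u -> D v -> (forall i, (i < K)%nat -> Rabs (u i - v i) <= r) ->
      Rabs (f u - f v) <= L * r.

Lemma lip_const K D c : lip K D (fun _ => c).
Proof.
  exists 0, (Rabs c); split; [lra|split; [apply Rabs_pos|split; [intros; lra|]]].
  intros u v r _ _ _; rewrite Rminus_diag, Rabs_R0; lra.
Qed.

Lemma lip_proj K D i B :
  (i < K)%nat -> 0 <= B -> (forall u, D u -> Rabs (u i) <= B) -> lip K D (fun u => u i).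
Proof.
  intros Hi HB HD; exists 1, B; split; [lra|split; [exact HB|split; [exact HD|]]].
  intros u v r _ _ H; specialize (H i Hi); lra.
Qed.

Lemma lip_opp K D f : lip K D f -> lip K D (fun u => - f u).
Proof.
  intros (L & B & HL & HB & Hb & H); exists L, B; repeat split; auto.
  - intros u Hu; rewrite Rabs_Ropp; auto.
  - intros u v r Hu Hv Huv. replace (- f u - - f v) with (- (f u - f v)) by ring.
    rewrite Rabs_Ropp; auto.
Qed.

Lemma lip_plus K D f g : lip K D f -> lip K D g -> lip K D (fun u => f u + g u).
Proof.
  intros (L & B & HL & HB & Hb & H) (L' & B' & HL' & HB' & Hb' & H').
  exists (L + L'), (B + B'); split; [lra|split; [lra|split]].
  - intros u Hu; eapply Rle_trans; [apply Rabs_triang|]. apply Rplus_le_compat; auto.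
  - intros u v r Hu Hv Huv.
    replace (f u + g u - (f v + g v)) with ((f u - f v) + (g u - g v)) by ring.
    eapply Rle_trans; [apply Rabs_triang|]. rewrite Rmult_plus_distr_r.
    apply Rplus_le_compat; auto.
Qed.

Lemma lip_mult K D f g : lip K D f -> lip K D g -> lip K D (fun u => f u * g u).
Proof.
  intros (L & B & HL & HB & Hb & H) (L' & B' & HL' & HB' & Hb' & H').
  exists (B * L' + L * B'), (B * B').
  split; [apply Rplus_le_le_0_compat; now apply Rmult_le_pos|].
  split; [now apply Rmult_le_pos|split].
  - intros u Hu; rewrite Rabs_mult; apply Rmult_le_compat; auto using Rabs_pos.
  - intros u v r Hu Hv Huv.
    replace (f u * g u - f v * g v) with (f u * (g u - g v) + (f u - f v) * g v) by ring.
    eapply Rle_trans; [apply Rabs_triang|]. rewrite !Rabs_mult.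
    replace ((B * L' + L * B') * r) with (B * (L' * r) + L * r * B') by ring.
    apply Rplus_le_compat; apply Rmult_le_compat; auto using Rabs_pos.
Qed.

Lemma lip_sum K D n (f : nat -> (nat -> R) -> R) :
  (forall i, (i < n)%nat -> lip K D (f i)) -> lip K D (fun u => sumR n (fun i => f i u)).
Proof.
  intros H; induction n as [|n IH]; simpl; [apply lip_const|].
  apply lip_plus; [apply IH; intros; apply H|apply H]; lia.
Qed.

Lemma lip_inv K D f d :
  0 < d -> (forall u, D u -> d <= Rabs (f u)) -> lip K D f -> lip K D (fun u => / f u).
Proof.
  intros Hd Hf (L & B & HL & HB & Hb & H).
  assert (Hd' : 0 < / d) by now apply Rinv_0_lt_compat.
  assert (Hi : forall u, D u -> f u <> 0 /\ Rabs (/ f u) <= / d).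
  { intros u Hu; specialize (Hf u Hu); split.
    - intros E; rewrite E, Rabs_R0 in Hf; lra.
    - rewrite Rabs_inv; now apply Rinv_le_contravar. }
  exists (/ d * L * / d), (/ d); split; [|split; [lra|split; [intros; now apply Hi|]]].
  - apply Rmult_le_pos; [apply Rmult_le_pos|]; lra.
  - intros u v r Hu Hv Huv; destruct (Hi u Hu) as [Nu Iu]; destruct (Hi v Hv) as [Nv Iv].
    replace (/ f u - / f v) with (- (/ f u * (f u - f v) * / f v)) by (field; auto).
    rewrite Rabs_Ropp, !Rabs_mult.
    replace (/ d * L * / d * r) with (/ d * (L * r) * / d) by ring.
    repeat apply Rmult_le_compat; auto using Rabs_pos, Rmult_le_pos.
Qed.

(** For [q < 1] the slope blows up at [0+], hence the gap between 0 and [d]. On [[d, B]] the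
    derivative [q c^q / c] is at most [q B^q / d]; a jump from a nonpositive point to one above [d]
    has length at least [d] and height at most [B^q]. The factor [q + 1] covers both cases. *)
Lemma rpow0_lip_away q d B : 0 < q -> 0 < d ->
  exists L, 0 <= L /\ forall s t, (s <= 0 \/ d <= s) -> (t <= 0 \/ d <= t) ->
    s <= B -> t <= B -> Rabs (rpow0 s q - rpow0 t q) <= L * Rabs (s - t).
Proof.
  intros Hq Hd; set (L := (q + 1) * (rpow0 B q / d)).
  assert (HW : 0 <= rpow0 B q / d) by (apply Rle_mult_inv_pos; [apply rpow0_ge0|exact Hd]).
  assert (HL : 0 <= L) by (apply Rmult_le_pos; lra).
  assert (Hlt : forall s t, (s <= 0 \/ d <= s) -> (t <= 0 \/ d <= t) -> t <= B -> s < t ->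
    rpow0 t q - rpow0 s q <= L * (t - s)).
  { intros s t Hs Ht HtB Hst.
    assert (HtB' : rpow0 t q <= rpow0 B q) by now apply rpow0_le.
    assert (H0 : 0 <= L * (t - s)) by (apply Rmult_le_pos; lra).
    destruct Ht as [Ht|Ht]; [rewrite !rpow0_npos; lra|].
    destruct Hs as [Hs|Hs].
    - rewrite (rpow0_npos s) by exact Hs.
      replace (L * (t - s)) with (rpow0 B q / d * ((q + 1) * (t - s))) by (unfold L; ring).
      apply Rle_trans with (rpow0 B q / d * d); [field_simplify; lra|].
      apply Rmult_le_compat_l; [exact HW|]. nra.
    - destruct (MVT_cor2 (fun x => Rpower x q) (fun x => q * Rpower x (q - 1)) s t Hst)
        as (c & Hc & Hsc); [intros; apply derivable_pt_lim_power; lra|].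
      rewrite !rpow0_pos, Hc by lra. apply Rmult_le_compat_r; [lra|].
      replace (Rpower c (q - 1)) with (Rpower c q / c).
      2:{ unfold Rminus.
          rewrite Rpower_plus, Rpower_Ropp, Rpower_1 by lra; reflexivity. }
      assert (Hcq : Rpower c q / c <= rpow0 B q / d).
      { apply Rmult_le_compat; [left; apply Rpower_gt0|left; apply Rinv_0_lt_compat; lra| |].
        - rewrite <- rpow0_pos by lra; apply rpow0_le; lra.
        - apply Rinv_le_contravar; lra. }
      unfold L; apply Rmult_le_compat; try lra.
      apply Rle_mult_inv_pos; [left; apply Rpower_gt0|lra]. }
  exists L; split; [exact HL|]. intros s t Hs Ht HsB HtB.
  destruct (Rtotal_order s t) as [H|[->|H]].
  - pose proof (rpow0_le s t q Hq ltac:(lra)). specialize (Hlt s t Hs Ht HtB H).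
    rewrite !Rabs_left1 by lra; lra.
  - rewrite !Rminus_diag, !Rabs_R0; lra.
  - pose proof (rpow0_le t s q Hq ltac:(lra)). specialize (Hlt t s Ht Hs HsB H).
    rewrite !Rabs_pos_eq by lra; lra.
Qed.

Lemma lip_rpow0 K D f q d : 0 < q -> 0 < d ->
  (forall u, D u -> f u <= 0 \/ d <= f u) -> lip K D f -> lip K D (fun u => rpow0 (f u) q).
Proof.
  intros Hq Hd Hf (L & B & HL & HB & Hb & H).
  destruct (rpow0_lip_away q d B Hq Hd) as (M & HM & Hpow).
  assert (HfB : forall u, D u -> f u <= B) by (intros u Hu; apply Rabs_bounds; auto).
  exists (M * L), (rpow0 B q); split; [now apply Rmult_le_pos|].
  split; [apply rpow0_ge0|split].
  - intros u Hu; rewrite Rabs_pos_eq by apply rpow0_ge0; apply rpow0_le; auto.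
  - intros u v r Hu Hv Huv; eapply Rle_trans; [apply Hpow; auto|].
    rewrite Rmult_assoc; apply Rmult_le_compat_l; auto.
Qed.

Lemma lip_spow K D f q d : 0 < q -> 0 < d ->
  (forall u, D u -> f u = 0 \/ d <= Rabs (f u)) -> lip K D f -> lip K D (fun u => spow q (f u)).
Proof.
  intros Hq Hd Hf H; unfold spow, Rminus.
  apply lip_plus; [|apply lip_opp]; apply lip_rpow0 with d; try exact Hq; try exact Hd;
    [|exact H| |apply lip_opp, H].
  all: intros u Hu; destruct (Hf u Hu) as [->|E]; [lra|].
  all: revert E; unfold Rabs; destruct (Rcase_abs (f u)); lra.
Qed.

(** * Exceptional sets parametrised by a hyperplane *)

(** Piece [n] of a countable decomposition of the hyperplane [u c = 0]; [E n] carries the conditions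
    under which the parametrisation is Lipschitz. *)
Definition slice (K c : nat) (E : nat -> (nat -> R) -> Prop) (n : nat) (u : nat -> R) : Prop :=
  u c = 0 /\ (forall i, (i < K)%nat -> Rabs (u i) <= INR (S n)) /\ E n u.

Lemma lip_coord K c E n i : (i < K)%nat -> lip K (slice K c E n) (fun u => u i).
Proof.
  intros Hi; apply lip_proj with (INR (S n)); [exact Hi|apply pos_INR|].
  intros u (_ & Hu & _); now apply Hu.
Qed.

(** The Lipschitz constants of the coordinates are rounded up to integers, so that a common one
    exists on each piece. *)
Lemma null_lip_param K c E (F : (nat -> R) -> nat -> R) :
  (c < K)%nat ->
  (forall n i, (i < K)%nat -> lip K (slice K c E n) (fun u => F u i)) ->
  lebesgue_null K (fun z => exists n u, slice K c E n u /\ forall i, (i < K)%nat -> z i = F u i).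
Proof.
  intros Hc HF; apply null_union; intros n.
  assert (Hr : forall (u v : nat -> R) r,
    (forall i, (i < K)%nat -> Rabs (u i - v i) <= r) -> 0 <= r).
  { intros u v r H; exact (Rle_trans _ _ _ (Rabs_pos _) (H c Hc)). }
  destruct (uniform_index K (fun i M => forall u v r, slice K c E n u -> slice K c E n v ->
    (forall l, (l < K)%nat -> Rabs (u l - v l) <= r) -> Rabs (F u i - F v i) <= INR M * r))
    as [M HM].
  - intros i a b Hab H u v r Hu Hv Huv; eapply Rle_trans; [apply H; eassumption|].
    apply Rmult_le_compat_r; [eauto|]. now apply le_INR.
  - intros i Hi; destruct (HF n i Hi) as (L & _ & _ & _ & _ & H).
    destruct (INR_unbounded L) as [M HM]; exists M; intros u v r Hu Hv Huv.
    eapply Rle_trans; [apply H; eassumption|]. apply Rmult_le_compat_r; [eauto|exact HM].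
  - apply null_lip_image with c (INR (S n)) (INR M);
      [exact Hc|apply lt_0_INR; lia|apply pos_INR| |intros; now apply HM].
    intros u (H1 & H2 & _); auto.
Qed.

(** The bound is stated for all larger indices, so that the piece can be moved further to meet other
    conditions. *)
Lemma coords_bounded K (u : nat -> R) :
  exists n, forall n', (n <= n')%nat -> forall i, (i < K)%nat -> Rabs (u i) <= INR (S n').
Proof.
  destruct (uniform_index K (fun i n => Rabs (u i) <= INR n)) as [n Hn].
  - intros i a b Hab H; apply le_INR in Hab; lra.
  - intros i _; apply INR_unbounded.
  - exists n; intros n' H i Hi; eapply Rle_trans; [apply Hn, Hi|]. apply le_INR; lia.
Qed.

Lemma null_coord_zero K c : (c < K)%nat -> lebesgue_null K (fun z => z c = 0).
Proof.
  intros Hc.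
  apply null_mono with (fun z => exists n u, slice K c (fun _ _ => True) n u /\
    forall i, (i < K)%nat -> z i = u i).
  - intros z Hz; destruct (coords_bounded K z) as [n Hn]; exists n, z.
    split; [|reflexivity]. split; [exact Hz|split; [now apply Hn|exact I]].
  - apply null_lip_param with (F := fun u => u); [exact Hc|].
    intros; now apply lip_coord.
Qed.

(* A kernel vector of the transpose, normalised by [l k = 1], has [m - 1] free entries, and it
   determines the [N > m - 1] entries of row [k] from the other rows; it is stored in that row. *)
Lemma null_not_tinj m N : (1 <= m)%nat -> (m <= N)%nat ->
  lebesgue_null (m * N + m) (fun z => ~ tinj m N (mat_of N z)).
Proof.
  intros Hm HmN; set (K := (m * N + m)%nat).
  set (row := fun k idx => andb (Nat.leb (k * N) idx) (Nat.ltb idx (k * N + N))).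
  (* In row [k], [idx - k * N] is the column and [u (k * N + i)] stores [l i / l k], which fits
     because [m <= N]. *)
  set (F := fun k (u : nat -> R) idx => if row k idx then
    - sumR m (fun i => u (i * N + (idx - k * N))%nat * u (k * N + i)%nat) else u idx).
  apply null_mono with (fun z => exists k, (k < m)%nat /\ exists n u,
    slice K (k * N + k) (fun _ _ => True) n u /\ forall i, (i < K)%nat -> z i = F k u i).
  - intros z Hz.
    assert (Hl : exists l k, (k < m)%nat /\ l k <> 0 /\
      forall j, (j < N)%nat -> tmul m (mat_of N z) l j = 0).
    { apply NNPP; intros Hno; apply Hz; intros l Hl k Hk; apply NNPP; intros Hlk.
      apply Hno; exists l, k; auto. }
    destruct Hl as (l & k & Hk & Hlk & Hl); exists k; split; [exact Hk|].
    (* Slot [(k, k)] would hold the normalised value 1; it is set to 0 instead. This is the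
       vanishing coordinate of the slice, and it removes the term [i = k] from the sum in [F]. *)
    set (u := fun idx => if row k idx then
      (if andb (Nat.ltb (idx - k * N) m) (negb (Nat.eqb idx (k * N + k)))
       then / l k * l (idx - k * N)%nat else 0) else z idx).
    destruct (coords_bounded K u) as [n Hn]; exists n, u; split.
    + split; [|split; [now apply Hn|exact I]].
      unfold u; rewrite Nat.eqb_refl, Bool.andb_false_r; destruct (row k _) eqn:E; [reflexivity|].
      exfalso; unfold row in E. apply Bool.andb_false_iff in E.
      rewrite Nat.leb_gt, Nat.ltb_ge in E; lia.
    + intros idx Hidx; unfold F; destruct (row k idx) eqn:E.
      2:{ unfold u; rewrite E; reflexivity. }
      unfold row in E; apply Bool.andb_true_iff in E as [E1 E2].
      apply Nat.leb_le in E1; apply Nat.ltb_lt in E2.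
      assert (Hj : exists j, (j < N)%nat /\ idx = (k * N + j)%nat)
        by (exists (idx - k * N)%nat; lia).
      destruct Hj as (j & Hj & ->). replace (k * N + j - k * N)%nat with j by lia.
      specialize (Hl j Hj).
      assert (Hl' : tmul m (mat_of N z) (fun i => / l k * l i) j = 0)
        by (rewrite tmul_scal, Hl; ring).
      unfold tmul in Hl'; rewrite (sumR_remove m k) in Hl' by exact Hk.
      rewrite Rinv_l, Rmult_1_r in Hl' by exact Hlk; unfold mat_of at 1 in Hl'.
      rewrite (sumR_ext m _ (fun i => if Nat.eqb i k then 0 else mat_of N z i j * (/ l k * l i)));
        [lra|].
      intros i Hi; destruct (Nat.eqb_spec i k) as [->|Hne].
      * replace (u (k * N + k)%nat) with 0; [ring|].
        unfold u; rewrite Nat.eqb_refl, Bool.andb_false_r; destruct (row k (k * N + k)%nat) eqn:E; [reflexivity|].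
        exfalso; unfold row in E; apply Bool.andb_false_iff in E.
        rewrite Nat.leb_gt, Nat.ltb_ge in E; lia.
      * f_equal.
        -- unfold u; replace (row k (i * N + j)%nat) with false; [reflexivity|].
           symmetry; apply Bool.andb_false_iff; rewrite Nat.leb_gt, Nat.ltb_ge; nia.
        -- unfold u; replace (row k (k * N + i)%nat) with true.
           ++ replace (k * N + i - k * N)%nat with i by lia.
              destruct (Nat.ltb_spec i m); [|lia].
              destruct (Nat.eqb_spec (k * N + i) (k * N + k)); [lia|reflexivity].
           ++ symmetry; apply Bool.andb_true_iff; rewrite Nat.leb_le, Nat.ltb_lt; lia.
  - apply null_union_bounded; [lia|]; intros k Hk.
    assert (HkN : (k * N + N <= m * N)%nat) by nia.
    apply null_lip_param; [unfold K; lia|].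
    intros n idx Hidx; unfold F; destruct (row k idx) eqn:E; [|now apply lip_coord].
    unfold row in E; apply Bool.andb_true_iff in E as [E1 E2].
    apply Nat.leb_le in E1; apply Nat.ltb_lt in E2.
    apply lip_opp, (lip_sum K _ m (fun i u => u (i * N + (idx - k * N))%nat * u (k * N + i)%nat)).
    intros i Hi; apply lip_mult; apply lip_coord; unfold K; nia.
Qed.

(* Column [j] is orthogonal to the multiplier [l], so its entry in row [k] is determined by the
   rest; this frees one coordinate, while the [m] coordinates of [y] are traded for those of [l]. *)
Lemma null_orthogonal_column q m N k j : 0 < q -> (k < m)%nat -> (j < N)%nat ->
  lebesgue_null (m * N + m) (fun z => exists l, l k <> 0 /\ tmul m (mat_of N z) l j = 0 /\
    feasible m N (mat_of N z) (vec_of m N z) (fun j => spow q (tmul m (mat_of N z) l j))).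
Proof.
  intros Hq Hk Hj; set (K := (m * N + m)%nat); set (c := (k * N + j)%nat).
  assert (Hc : (c < m * N)%nat) by (unfold c; nia).
  (* The last [m] slots of [u] hold [l], so [T u t] is the inner product of column [t] with [l] for
     [t <> j]. For [t = j] the entry at [c] is replaced by 0, so [T u j] equals minus the missing
     term [z c * l k]. *)
  set (T := fun (u : nat -> R) t => sumR m (fun i => u (i * N + t)%nat * u (m * N + i)%nat)).
  set (E := fun n u => / INR (S n) <= Rabs (u (m * N + k)%nat) /\
    forall t, (t < N)%nat -> t <> j -> T u t = 0 \/ / INR (S n) <= Rabs (T u t)).
  (* The three cases recover the missing entry of column [j], the other entries of the matrix, and
     the entries of [y] from feasibility. Column [j] drops out of the last sum because its inner
     product with [l] is 0 and [spow q 0 = 0]. *)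
  set (F := fun (u : nat -> R) idx => if Nat.eqb idx c then - (T u j * / u (m * N + k)%nat)
    else if Nat.ltb idx (m * N) then u idx
    else sumR N (fun t => if Nat.eqb t j then 0
                          else u ((idx - m * N) * N + t)%nat * spow q (T u t))).
  apply null_mono with (fun z => exists n u, slice K c E n u /\
    forall i, (i < K)%nat -> z i = F u i).
  - intros z (l & Hlk & Hlj & Hfeas).
    set (u := fun idx => if Nat.eqb idx c then 0 else if Nat.ltb idx (m * N) then z idx
                         else l (idx - m * N)%nat).
    assert (Huc : u c = 0) by (unfold u; now rewrite Nat.eqb_refl).
    assert (HuA : forall i t, (i < m)%nat -> (t < N)%nat -> (i <> k \/ t <> j) ->
      u (i * N + t)%nat = mat_of N z i t).
    { intros i t Hi Ht Hne; unfold u.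
      destruct (Nat.eqb_spec (i * N + t) c) as [Ec|_]; [unfold c in Ec; exfalso|].
      - destruct (Nat.lt_trichotomy i k) as [H|[H|H]]; nia.
      - destruct (Nat.ltb_spec (i * N + t) (m * N)); [reflexivity|nia]. }
    assert (Hul : forall i, u (m * N + i)%nat = l i).
    { intros i; unfold u. destruct (Nat.eqb_spec (m * N + i) c); [lia|].
      destruct (Nat.ltb_spec (m * N + i) (m * N)); [lia|]. f_equal; lia. }
    assert (HT : forall t, (t < N)%nat -> t <> j -> T u t = tmul m (mat_of N z) l t).
    { intros t Ht Hne; apply sumR_ext; intros i Hi; rewrite HuA, Hul by auto; reflexivity. }
    assert (HTj : T u j = - (z c * l k)).
    { unfold T; rewrite (sumR_remove m k) by exact Hk; fold c; rewrite Huc.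
      unfold tmul in Hlj; rewrite (sumR_remove m k) in Hlj by exact Hk.
      unfold mat_of at 1 in Hlj; fold c in Hlj.
      rewrite (sumR_ext m _ (fun i => if Nat.eqb i k then 0 else mat_of N z i j * l i)); [lra|].
      intros i Hi; destruct (Nat.eqb_spec i k); [reflexivity|].
      rewrite HuA, Hul by auto; reflexivity. }
    destruct (coords_bounded K u) as [n1 Hn1].
    destruct (inv_INR_small (Rabs (l k))) as [n2 Hn2]; [now apply Rabs_pos_lt|].
    assert (Hmono : forall a b x, (a <= b)%nat -> / INR (S a) <= x -> / INR (S b) <= x).
    { intros a b x Hab Hx; eapply Rle_trans; [|exact Hx].
      apply Rinv_le_contravar; [apply lt_0_INR|apply le_INR]; lia. }
    destruct (uniform_index N (fun t n => T u t = 0 \/ / INR (S n) <= Rabs (T u t))) as [n3 Hn3].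
    { intros t a b Hab [H|H]; [now left|right; eauto]. }
    { intros t _; destruct (Req_dec (T u t) 0) as [H|H]; [exists O; now left|].
      destruct (inv_INR_small (Rabs (T u t))) as [n Hn]; [now apply Rabs_pos_lt|].
      exists n; now right. }
    (* Each of the three conditions persists when its index grows, so the sum of the indices meets
       them all. *)
    exists (n1 + n2 + n3)%nat, u; split; [split; [exact Huc|split]|].
    + apply Hn1; lia.
    + split; [rewrite Hul; apply (Hmono n2); [lia|exact Hn2]|].
      intros t Ht _; destruct (Hn3 t Ht) as [H|H]; [now left|right; apply (Hmono n3); [lia|exact H]].
    + intros idx Hidx; unfold F; destruct (Nat.eqb_spec idx c) as [->|Hne].
      { rewrite HTj, Hul; field; exact Hlk. }
      destruct (Nat.ltb_spec idx (m * N)) as [Hlt|Hge].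
      { unfold u; destruct (Nat.eqb_spec idx c); [contradiction|].
        destruct (Nat.ltb_spec idx (m * N)); [reflexivity|lia]. }
      assert (Hi : (idx - m * N < m)%nat) by (unfold K in Hidx; lia).
      specialize (Hfeas _ Hi); unfold vec_of in Hfeas.
      replace (m * N + (idx - m * N))%nat with idx in Hfeas by lia.
      rewrite <- Hfeas; apply sumR_ext; intros t Ht.
      destruct (Nat.eqb_spec t j) as [->|Htj]; [rewrite Hlj, spow_0; ring|].
      rewrite HuA, HT by auto; reflexivity.
  - apply null_lip_param; [unfold K; lia|].
    intros n idx Hidx.
    assert (Hd : 0 < / INR (S n)) by (apply Rinv_0_lt_compat, lt_0_INR; lia).
    assert (HT : forall t, (t < N)%nat -> lip K (slice K c E n) (fun u => T u t)).
    { intros t Ht.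
      apply (lip_sum K _ m (fun i u => u (i * N + t)%nat * u (m * N + i)%nat)).
      intros i Hi; apply lip_mult; apply lip_coord; unfold K; nia. }
    unfold F; destruct (Nat.eqb idx c).
    + apply lip_opp, lip_mult; [now apply HT|].
      apply lip_inv with (/ INR (S n)); [exact Hd| |apply lip_coord; unfold K; lia].
      intros u (_ & _ & H & _); exact H.
    + destruct (Nat.ltb_spec idx (m * N)) as [Hlt|Hge]; [now apply lip_coord|].
      apply (lip_sum K _ N (fun t u => if Nat.eqb t j then 0
                          else u ((idx - m * N) * N + t)%nat * spow q (T u t))).
      intros t Ht; destruct (Nat.eqb_spec t j); [apply lip_const|].
      apply lip_mult; [apply lip_coord; unfold K in *; nia|].
      apply lip_spow with (/ INR (S n)); [exact Hq|exact Hd| |now apply HT].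
      intros u (_ & _ & _ & H); now apply H.
Qed.

Theorem theorem4p1 (p : R) (m N : nat) :
  1 < p -> (1 <= m)%nat -> (2 * m - 1 <= N)%nat ->
  lebesgue_null (m * N + m)
    (fun z => ~ good p m N (mat_of N z) (vec_of m N z)).
Proof.
  intros Hp Hm HN.
  assert (Hq : 0 < / (p - 1)) by (apply Rinv_0_lt_compat; lra).
  apply null_mono with (fun z => z (m * N)%nat = 0 \/ ~ tinj m N (mat_of N z) \/
    exists k, (k < m)%nat /\ exists j, (j < N)%nat /\
      exists l, l k <> 0 /\ tmul m (mat_of N z) l j = 0 /\
        feasible m N (mat_of N z) (vec_of m N z)
          (fun j => spow (/ (p - 1)) (tmul m (mat_of N z) l j))).
  - intros z Hz; destruct (classic (tinj m N (mat_of N z))) as [Hinj|]; [|tauto].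
    destruct (not_good_multiplier p m N _ _ Hp Hm Hinj Hz) as (l & j & Hj & Hlj & Hfeas).
    destruct (classic (exists k, (k < m)%nat /\ l k <> 0)) as [(k & Hk & Hlk)|Hl0].
    { right; right; exists k; split; [exact Hk|]; exists j; split; [exact Hj|]; exists l; auto. }
    (* A zero multiplier yields the zero vector, so [y = 0]; its first entry, stored at [m * N],
       already vanishes. *)
    left; specialize (Hfeas O ltac:(lia)); unfold vec_of in Hfeas; rewrite Nat.add_0_r in Hfeas.
    rewrite <- Hfeas, (sumR_ext N _ (fun _ => 0)); [apply sumR_zero|].
    intros t _; replace (tmul m (mat_of N z) l t) with 0; [rewrite spow_0; ring|].
    symmetry; unfold tmul; rewrite (sumR_ext m _ (fun _ => 0)); [apply sumR_zero|].
    intros i Hi; replace (l i) with 0; [ring|].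
    symmetry; apply NNPP; intros H; apply Hl0; exists i; auto.
  - apply null_or; [apply null_coord_zero; lia|apply null_or; [apply null_not_tinj; lia|]].
    apply null_union_bounded; [lia|]; intros k Hk.
    apply null_union_bounded; [lia|]; intros j Hj.
    now apply null_orthogonal_column.
Qed.
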